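(* Let $\alpha$ be a composition. Then $$\mathcal S_\alpha=\sum_\beta d_{\alpha\beta}F_\beta,$$ summed over compositions $\beta$, where $d_{\alpha\beta}$ is the number of standard augmented fillings (SAFs) $T$ of shape $\gamma$, for some weak composition $\gamma$ with positive last part and $\alpha(\gamma)=\alpha$, such that $\beta(\mathcal D(T))=\beta$; equivalently, $d_{\alpha\beta}$ is the number of standard ComTs $T$ of shape $\alpha$ with $\beta(\mathcal D(T))=\beta$.
   Context: A weak composition is a finite sequence $\gamma=(\gamma_1,\dots,\gamma_n)$ of nonnegative integers; a composition has all parts positive; $|\gamma|=\sum\gamma_i$; $\alpha(\gamma)$ is obtained from $\gamma$ by deleting zero parts. For $S=\{i_1<\dots<i_{k-1}\}\subseteq\{1,\dots,N-1\}$, $\beta(S)=(i_1,i_2-i_1,\dots,N-i_{k-1})$. For a composition $\alpha=(\alpha_1,\dots,\alpha_k)$, $M_\alpha=\sum_{i_1<\dots<i_k}x_{i_1}^{\alpha_1}\cdots x_{i_k}^{\alpha_k}$ and $F_\alpha=\sum_\beta M_\beta$ over compositions $\beta$ such that $\alpha$ is obtained from $\beta$ by adding adjacent parts. SSAFs. The augmented diagram of $\gamma=(\gamma_1,\dots,\gamma_n)$ has cells $(i,j)$, $1\le i\le n$ (row, from top), $0\le j\le\gamma_i$ (column); column $0$ is the basement, cell $(i,0)$ containing $i$. An augmented filling assigns positive integers to non-basement cells. Cells $(i,j),(i',j')$ attack if $j=j'$, or $j=j'+1$ and $i>i'$; non-attacking means distinct attacking cells (basement included) have distinct entries. When comparing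 entries in a triple, of two equal entries the one appearing first when read top to bottom, right to left counts as smaller. Type A triple: $c=(i,k-1)$, $a=(i,k)$, $b=(j,k)$, $i<j$, $k\ge1$, $\gamma_i\ge\gamma_j$; inversion triple if in increasing order $a<c<b$, $c<b<a$ or $b<a<c$. Type B triple: $a=(i,k)$, $b=(j,k)$, $c=(j,k+1)$, $i<j$, $k\ge0$, $\gamma_j>\gamma_i$; inversion triple if in increasing order $a<c<b$, $c<b<a$ or $b<a<c$. An SSAF of shape $\gamma$ is a non-attacking augmented filling with rows (basement included) weakly decreasing left to right and all type A and B triples inversion triples; $x^F=\prod_i x_i^{w_i(F)}$ with $w_i(F)$ the number of non-basement cells containing $i$. An SAF of shape $\gamma$ is an SSAF with $x^F=x_1x_2\cdots x_{|\gamma|}$; its descent set $\mathcal D(F)$ is the set of $i\in\{1,\dots,|\gamma|-1\}$ such that the non-basement cell containing $i+1$ is not in a column strictly left of the non-basement cell containing $i$. $\mathcal A_\gamma=\sum_F x^F$ over SSAFs of shape $\gamma$; $\mathcal S_\alpha=\sum_\gamma \mathcal A_\gamma$ over weak compositions $\gamma$ with positive last part and $\alpha(\gamma)=\alpha$. ComTs. For a composition $\alpha=(\alpha_1,\dots,\alpha_\ell)$ with largest part $m$, a ComT of shape $\alpha$ is a filling of the left-justified diagram with $\alpha_i$ cells in row $i$ by positive integers with rows weakly decreasing left to right, leftmost column strictly increasing top to bottom, and such that, padding rows with $0$'s to an $\ell\times m$ array $\hat T$, for $1\le i<j\le\ell$, $2\le k\le m$: $\hat T(j,k)\ne0$ and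 $\hat T(j,k)\ge\hat T(i,k)$ imply $\hat T(j,k)>\hat T(i,k-1)$. It is standard if its $N$ cells contain $1,\dots,N$ once each; then $\mathcal D(T)$ is the set of $i\in\{1,\dots,N-1\}$ such that $i+1$ does not appear in a column strictly left of the column of $i$. *)

(* Defs.v *)
From mathcomp Require Import all_boot all_order all_algebra.
From mathcomp Require Import finmap multiset.
From mathcomp Require Import boolp classical_sets functions cardinality fsbigop.

Set Implicit Arguments.
Unset Strict Implicit.
Unset Printing Implicit Defensive.

Import GRing.Theory.

Local Open Scope classical_set_scope.
Local Open Scope ring_scope.
Local Open Scope nat_scope.

(** * Formal power series in x_1, x_2, ... *)

(** A monomial is the multiset of its variable indices (the multiplicity of [i]
    is the exponent of [x_i]); a series is its coefficient function. The index
    [0] is available in the type, but no series below involves [x_0]. *)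
Notation monomial := ({mset nat}%mset).

Definition fps := monomial -> int.

Definition mono (u : monomial) : fps := fun m => (m == u)%:R%R.

(** Infinite sums are taken coefficientwise. [\sum_(i \in A)] is [0] when the
    support is infinite; the [summable_*] lemmas at the end of this file show
    that every family summed below is summable. *)
Definition summable (I : choiceType) (A : set I) (f : I -> fps) : Prop :=
  forall m, finite_set [set i | A i /\ f i m <> 0%R].

Definition psum (I : choiceType) (A : set I) (f : I -> fps) : fps :=
  fun m => (\sum_(i \in A) f i m)%R.

(** * Compositions *)

(** Weak compositions are arbitrary elements of [seq nat]; the weight is [sumn]. *)
Definition is_composition (a : seq nat) : bool := all (leq 1) a.

Definition compress (g : seq nat) : seq nat := [seq x <- g | 0 < x].

(** For [g = [::]] the condition on the last part is vacuous, so that the empty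
    composition has exactly one expansion, [[::]]. *)
Definition expansion (a g : seq nat) : Prop := 0 < last 1 g /\ compress g = a.

(** beta(S) for the subset S of {1, ..., N-1} listed increasingly by [s]. *)
Definition beta (N : nat) (s : seq nat) : seq nat :=
  if N == 0 then [::] else pairmap (fun x y => y - x) 0 (rcons s N).

(** [a] is obtained from [b] by adding adjacent parts: [bs] cuts [b] into
    nonempty consecutive blocks whose sums are the parts of [a]. *)
Definition coarsening (a b : seq nat) : Prop :=
  exists bs : seq (seq nat),
    [/\ [::] \notin bs, flatten bs = b & map sumn bs = a].

(** * Monomial and fundamental quasisymmetric functions *)

Definition M_index (a : seq nat) : set (seq nat) :=
  [set i | [/\ size i = size a, all (leq 1) i & sorted ltn i]].

Definition M_term (a i : seq nat) : monomial :=
  \big[msetD/mset0]_(p <- zip i a) msetn p.2 p.1.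

Definition qsym_M (a : seq nat) : fps :=
  psum (M_index a) (fun i => mono (M_term a i)).

Definition F_index (a : seq nat) : set (seq nat) :=
  [set b | is_composition b /\ coarsening a b].

Definition qsym_F (a : seq nat) : fps := psum (F_index a) qsym_M.

(** * Fillings *)

(** A filling is the list of its rows from top to bottom, each row being the
    list of its (non-basement) entries from left to right; its shape is
    [seq.shape]. Rows and columns are numbered from 1 and column 0 is the
    basement. *)
Definition filling := seq (seq nat).

Definition part (g : seq nat) (i : nat) : nat := nth 0 g i.-1.

(** 1-based access, padding with 0. *)
Definition entry (T : filling) (i k : nat) : nat := nth 0 (nth [::] T i.-1) k.-1.

Definition content (T : filling) : monomial := seq_mset (flatten T).

Definition positive_entries (T : filling) : bool := all (all (leq 1)) T.

(** Column of the first cell containing [v] (the only one if [T] is standard). *)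
Definition column (T : filling) (v : nat) : nat :=
  (index v (nth [::] T (find (fun r => v \in r) T))).+1.

(** The set {1, ..., N-1} cut down to the descents, listed increasingly. *)
Definition descents (T : filling) : seq nat :=
  [seq i <- iota 1 (size (flatten T)).-1 | ~~ (column T i.+1 < column T i)].

Definition descent_composition (T : filling) : seq nat :=
  beta (size (flatten T)) (descents T).

(** * Semi-standard augmented fillings *)

Definition cell := (nat * nat)%type.

Definition in_aug_diagram (g : seq nat) (c : cell) : bool :=
  (0 < c.1 <= size g) && (c.2 <= part g c.1).

Definition aug_entry (T : filling) (c : cell) : nat :=
  if c.2 == 0 then c.1 else entry T c.1 c.2.

Definition attack (c d : cell) : bool :=
  (c.2 == d.2) || ((c.2 == d.2.+1) && (d.1 < c.1)).

Definition non_attacking (g : seq nat) (T : filling) : Prop :=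
  forall c d : cell, in_aug_diagram g c -> in_aug_diagram g d ->
    c != d -> attack c d -> aug_entry T c != aug_entry T d.

(** Columns from right to left, each column from top to bottom. *)
Definition read_before (c d : cell) : bool :=
  (d.2 < c.2) || ((c.2 == d.2) && (c.1 < d.1)).

Definition cell_lt (T : filling) (c d : cell) : bool :=
  (aug_entry T c < aug_entry T d)
  || ((aug_entry T c == aug_entry T d) && read_before c d).

Definition inversion_triple (T : filling) (a b c : cell) : bool :=
  [|| cell_lt T a c && cell_lt T c b,
      cell_lt T c b && cell_lt T b a
    | cell_lt T b a && cell_lt T a c].

Definition type_A_ok (g : seq nat) (T : filling) : Prop :=
  forall i j k : nat, 0 < i -> i < j -> 0 < k -> part g j <= part g i ->
    in_aug_diagram g (i, k) -> in_aug_diagram g (j, k) ->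
    inversion_triple T (i, k) (j, k) (i, k.-1).

Definition type_B_ok (g : seq nat) (T : filling) : Prop :=
  forall i j k : nat, 0 < i -> i < j -> part g i < part g j ->
    in_aug_diagram g (i, k) -> in_aug_diagram g (j, k.+1) ->
    inversion_triple T (i, k) (j, k) (j, k.+1).

Definition aug_rows_decreasing (g : seq nat) (T : filling) : Prop :=
  forall i k : nat, in_aug_diagram g (i, k.+1) ->
    aug_entry T (i, k.+1) <= aug_entry T (i, k).

Definition SSAF (g : seq nat) : set filling :=
  [set T | [/\ shape T = g, positive_entries T & non_attacking g T] /\
           [/\ aug_rows_decreasing g T, type_A_ok g T & type_B_ok g T]].

Definition SAF (g : seq nat) : set filling :=
  [set T | SSAF g T /\ content T = seq_mset (iota 1 (sumn g))].

Definition dem_atom (g : seq nat) : fps :=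
  psum (SSAF g) (fun T => mono (content T)).

Definition quasi_schur (a : seq nat) : fps := psum (expansion a) dem_atom.

(** * Composition tableaux *)

Definition ComT (a : seq nat) : set filling :=
  [set T | [/\ shape T = a, positive_entries T,
      all (sorted geq) T,
      (forall i j, 0 < i -> i < j -> j <= size a -> entry T i 1 < entry T j 1)
    & (forall i j k, 0 < i -> i < j -> j <= size a ->
         2 <= k <= \max_(x <- a) x ->
         entry T j k != 0 -> entry T i k <= entry T j k ->
         entry T i k.-1 < entry T j k)]].

Definition standard_ComT (a : seq nat) : set filling :=
  [set T | ComT a T /\ perm_eq (flatten T) (iota 1 (sumn a))].

(** * The coefficients *)

(** [#|` fset_set A|] is the cardinal of a finite set [A]; finiteness of the two
    sets counted is [finite_d_SAF_set] and [finite_d_ComT_set]. *)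
Definition d_SAF_set (a b : seq nat) : set filling :=
  [set T | (exists2 g, expansion a g & SAF g T) /\ descent_composition T = b].

Definition d_SAF (a b : seq nat) : nat := #|` fset_set (d_SAF_set a b)|%fset.

Definition d_ComT_set (a b : seq nat) : set filling :=
  [set T | standard_ComT a T /\ descent_composition T = b].

Definition d_ComT (a b : seq nat) : nat := #|` fset_set (d_ComT_set a b)|%fset.

Definition composition_set : set (seq nat) := [set b | is_composition b].

(** * Well-definedness of the sums and cardinals above *)

Lemma finite_bounded_seqs (T : eqType) (l : seq T) (n : nat) :
  finite_set [set s : seq T | size s <= n /\ {subset s <= l}].
Proof.
elim: n => [|n IHn].
  apply: (sub_finite_set _ (finite_set1 [::])) => s /= [+ _].
  by rewrite leqn0 => /nilP.
apply: (@sub_finite_set _ _ ([set [::]] `|`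
  [set x :: s | x in [set` l] & s in
     [set s : seq T | size s <= n /\ {subset s <= l}]])).
  case=> [|x s] /= [sn sl]; first by left.
  right; exists x; first exact/sl/mem_head.
  by exists s => //; split=> // y ys; apply: sl; rewrite in_cons ys orbT.
rewrite finite_setU; split; first exact: finite_set1.
by apply: finite_image2.
Qed.

Lemma mono_neq0 (u m : monomial) : mono u m <> 0%R -> m = u.
Proof. by rewrite /mono; case: eqP. Qed.

Lemma content_perm (T : filling) (m : monomial) :
  m = content T -> perm_eq (flatten T) m.
Proof. by move=> ->; rewrite perm_sym; apply: perm_eq_seq_mset. Qed.

Lemma finite_fillings (G : set (seq nat)) (l : seq nat) : finite_set G ->
  finite_set [set T : filling | G (shape T) /\ perm_eq (flatten T) l].
Proof.
move=> finG; apply: (sub_finite_set _ (finite_image2 (fun g s => reshape g s)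
  finG (finite_bounded_seqs l (size l)))) => T /= [GT Tl].
exists (shape T) => //; exists (flatten T); last exact: flattenK.
by split=> [|x]; rewrite ?(perm_size Tl) // (perm_mem Tl).
Qed.

Lemma mem_M_term (a i : seq nat) (x : nat) :
  is_composition a -> size i = size a -> x \in i -> x \in M_term a i.
Proof.
rewrite /M_term; elim: i a => [|y i IHi] [|p a] //= /andP[p0 ca] [ia].
rewrite in_cons big_cons in_msetD in_msetn p0 /= => /orP[->//|xi].
by rewrite IHi ?orbT.
Qed.

Lemma summable_M (a : seq nat) : is_composition a ->
  summable (M_index a) (fun i => mono (M_term a i)).
Proof.
move=> ca m; apply: (sub_finite_set _ (finite_bounded_seqs m (size a))).
move=> i [[ia _ _] /mono_neq0 ->]; split; first by rewrite ia.
by move=> x; apply: mem_M_term.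
Qed.

Lemma leq_sumn (x : nat) (s : seq nat) : x \in s -> x <= sumn s.
Proof.
elim: s => //= y s IHs; rewrite in_cons => /orP[/eqP->|/IHs]; first exact: leq_addr.
by move=> /leq_trans; apply; apply: leq_addl.
Qed.

Lemma size_composition (b : seq nat) : is_composition b -> size b <= sumn b.
Proof. by elim: b => //= x b IHb /andP[x0 /IHb]; rewrite -addn1 addnC; apply: leq_add. Qed.

Lemma finite_F_index (a : seq nat) : finite_set (F_index a).
Proof.
apply: (sub_finite_set _ (finite_bounded_seqs (iota 0 (sumn a).+1) (sumn a))).
move=> b [cb [bs [_ bsb bsa]]].
have eqs : sumn b = sumn a.
  by rewrite -bsb -bsa; elim: (bs) => //= s ss <-; rewrite sumn_cat.
split; first by rewrite -eqs size_composition.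
by move=> x xb; rewrite mem_iota /= ltnS -eqs leq_sumn.
Qed.

Lemma summable_F (a : seq nat) : summable (F_index a) qsym_M.
Proof. by move=> m; apply: sub_finite_set (finite_F_index a) => b []. Qed.

Lemma summable_dem_atom (g : seq nat) :
  summable (SSAF g) (fun T => mono (content T)).
Proof.
move=> m; apply: (sub_finite_set _ (finite_fillings m (finite_set1 g))).
by move=> T [[[Tg _ _] _] /mono_neq0 mT]; split=> //; apply: content_perm.
Qed.

(** The first column of an SSAF repeats the basement. *)
Lemma SSAF_col1 (g : seq nat) (T : filling) (i : nat) :
  SSAF g T -> 0 < i <= size g -> 0 < part g i -> entry T i 1 = i.
Proof.
move=> [[Tg posT naT] [decT _ _]] iP gi.
have i1 : in_aug_diagram g (i, 1) by rewrite /in_aug_diagram /= iP.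
have := decT i 0 i1; rewrite /aug_entry /= leq_eqVlt => /orP[/eqP //|lti].
move: iP i1 => /andP[i0 ig] i1.
have gt0 : 0 < entry T i 1.
  have iT : i.-1 < size T by rewrite -(size_map size) -/(shape T) Tg prednK.
  move/allP: posT => /(_ (nth [::] T i.-1)) /(_ (mem_nth _ iT)) /allP; apply.
  apply: mem_nth; rewrite -(nth_map _ 0 size) //.
  by rewrite -/(shape T) Tg.
have : aug_entry T (i, 1) != aug_entry T (entry T i 1, 0).
  apply: naT; rewrite ?/attack ?xpair_eqE ?andbF //=.
  by rewrite /in_aug_diagram /= gt0 (leq_trans (ltnW lti)).
by rewrite /aug_entry /= eqxx.
Qed.

Lemma finite_expansions (a l : seq nat) : finite_set
  [set g | expansion a g /\ exists2 T, SSAF g T & perm_eq (flatten T) l].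
Proof.
apply: (sub_finite_set _ (finite_bounded_seqs (0 :: a) (sumn l))).
move=> g [[lastg ga] [T gT Tl]]; split.
  have [->//|g0] := eqVneq g [::].
  have sg : 0 < size g by case: (g) g0.
  have gP : 0 < part g (size g).
    by rewrite /part nth_last; case: (g) g0 lastg.
  have sgP : 0 < size g <= size g by rewrite sg leqnn.
  have := SSAF_col1 gT sgP gP; rewrite /entry => <-.
  apply: leq_sumn; rewrite -(perm_mem Tl).
  case: gT => [[Tg _ _] _].
  have iT : (size g).-1 < size T by rewrite -(size_map size) -/(shape T) Tg prednK.
  apply/flattenP; exists (nth [::] T (size g).-1); first exact: mem_nth.
  by apply: mem_nth; rewrite -(nth_map _ 0 size) // -/(shape T) Tg.
move=> x xg; rewrite in_cons -ga mem_filter xg andbT lt0n.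
by case: eqP.
Qed.

Lemma summable_quasi_schur (a : seq nat) : summable (expansion a) dem_atom.
Proof.
move=> m; apply: (sub_finite_set _ (finite_expansions a m)) => g [ag gm].
split=> //; apply: contrapT => noT; apply: gm.
rewrite /dem_atom /psum fsbig1 // => T gT.
apply: contrapT => /mono_neq0/content_perm Tm; apply: noT.
by exists T.
Qed.

Lemma sumn_compress (g : seq nat) : sumn (compress g) = sumn g.
Proof. by elim: g => //= -[|x] g IHg //=; rewrite IHg. Qed.

Lemma finite_SAFs (a : seq nat) :
  finite_set [set T | exists2 g, expansion a g & SAF g T].
Proof.
apply: (sub_finite_set _ (finite_fillings (iota 1 (sumn a))
  (finite_expansions a (iota 1 (sumn a))))) => T [g ag [gT cT]].
have Tl : perm_eq (flatten T) (iota 1 (sumn a)).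
  by case: ag => _ <-; rewrite sumn_compress; apply/eq_seq_msetP.
have Tg : shape T = g by case: gT => -[].
split=> //=; rewrite Tg; split=> //; by exists T.
Qed.

Lemma finite_d_SAF_set (a b : seq nat) : finite_set (d_SAF_set a b).
Proof. by apply: sub_finite_set (finite_SAFs a) => T []. Qed.

Lemma finite_d_ComT_set (a b : seq nat) : finite_set (d_ComT_set a b).
Proof.
apply: (sub_finite_set _ (finite_fillings (iota 1 (sumn a)) (finite_set1 a))).
by move=> T [[[Ta _ _ _ _] ?] _].
Qed.

Lemma summable_expansion_F (a : seq nat) :
  summable composition_set (fun b => (qsym_F b *+ d_SAF a b)%R).
Proof.
move=> m; apply: (sub_finite_set _ (finite_image descent_composition (finite_SAFs a))).
move=> b [_ bm]; apply: contrapT => noT; apply: bm.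
suff -> : d_SAF a b = 0 by rewrite mulr0n.
rewrite /d_SAF (_ : d_SAF_set a b = set0) ?fset_set0 ?cardfs0 //.
by apply/seteqP; split=> // T [aT Tb]; apply: noT; exists T.
Qed.

(* Main.v *)
(** The first column of an SSAF repeats its basement, hence deleting the empty
    rows is a content- and column-preserving bijection from the SSAFs whose
    shape expands [a] onto the ComTs of shape [a]; its inverse puts each row
    back at the height given by its first entry. This identifies the two counts
    [d_SAF] and [d_ComT], and reduces the expansion to ComTs.

    The entries of a column of a ComT are distinct, so its cells can be numbered
    by increasing entry, equal entries being numbered from right to left. This
    standardization is again a ComT, and for a monomial [m] with sorted word [w]
    it identifies the ComTs of content [m] with the standard ComTs [S] such that
    [w] increases strictly at each descent of [S]. The latter condition says
    that the descent composition of [S] is a coarsening of the exponents of [m],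
    i.e. that [m] occurs, with coefficient 1, in the fundamental function of
    [S]. *)

Require Import Defs.
From mathcomp Require Import all_boot all_order all_algebra.
From mathcomp Require Import finmap multiset.
From mathcomp Require Import boolp classical_sets functions cardinality fsbigop.
From mathcomp Require Import zify.

Set Implicit Arguments.
Unset Strict Implicit.
Unset Printing Implicit Defensive.

Import Order.TTheory GRing.Theory.

Local Open Scope classical_set_scope.
Local Open Scope nat_scope.

(** * Finitely supported sums *)

Lemma fsbig_only1 (R : Type) (idx : R) (op : Monoid.com_law idx)
    (I : choiceType) (A : set I) (F : I -> R) (i : I) :
    A i -> (forall j, A j -> j <> i -> F j = idx) ->
  \big[op/idx]_(j \in A) F j = F i.
Proof.
move=> Ai Fidx; rewrite -(fsbig_widen [set i]) ?fsbig_set1 //.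
- by move=> _ ->.
- by move=> j [/Fidx].
Qed.

Arguments fsbig_only1 {R idx op I A F} i.

Lemma fsbig_fibers (R : Type) (idx : R) (op : Monoid.com_law idx)
    (I J : choiceType) (f : I -> J) (X : set I) (A : set J) (F : I -> R) :
    finite_set (X `&` F @^-1` [set~ idx]) -> X `<=` f @^-1` A ->
  \big[op/idx]_(x \in X) F x =
  \big[op/idx]_(j \in A) \big[op/idx]_(x \in X `&` f @^-1` [set j]) F x.
Proof.
set S := X `&` _ => finS XA.
have fiberS j : \big[op/idx]_(x \in X `&` f @^-1` [set j]) F x =
    \big[op/idx]_(x \in S) if x \in f @^-1` [set j] then F x else idx.
  rewrite -fsbig_mkcondr; apply/esym/fsbig_widen => x /=; first by case=> -[].
  by move=> [[Xx fx] /= nS]; apply: contrapT => Fx; apply: nS.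
under [RHS]eq_fsbigr do rewrite fiberS.
rewrite -[RHS](fsbig_widen (f @` S)); first last.
- move=> j [_ /= nSj]; apply: fsbig1 => x Sx.
  by rewrite memNset // => fx; apply: nSj; exists x.
- by move=> _ [x [Xx _] <-]; apply: XA.
rewrite fsbig_supp -/S exchange_fsbig //; last exact: finite_image.
apply: eq_fsbigr => x; rewrite inE => Sx.
rewrite (fsbig_only1 (f x)) => [||j _ fx]; first by rewrite mem_set.
  by exists x.
by rewrite memNset // => /esym.
Qed.

Lemma fsum_const (V : nmodType) (I : choiceType) (X : set I) (c : V) :
  finite_set X -> (\sum_(x \in X) c = c *+ #|` fset_set X|%fset)%R.
Proof.
by move=> finX; rewrite fsbig_finite //= big_const_seq count_predT iter_addr_0.
Qed.

Lemma fsum_indicator (R : pzSemiRingType) (I : choiceType) (A P : set I) :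
  (\sum_(i \in A) (`[< P i >]%:R : R) = \sum_(i \in A `&` P) (1 : R))%R.
Proof.
rewrite fsbig_mkcondr; apply: eq_fsbigr => i _.
by case: asboolP => Pi; [rewrite mem_set|rewrite memNset].
Qed.

Lemma fsum_indicator_bij (R : pzSemiRingType) (I J : choiceType)
    (A P : set I) (B Q : set J) (f : I -> J) :
    set_bij (A `&` P) (B `&` Q) f ->
  (\sum_(i \in A) (`[< P i >]%:R : R) = \sum_(j \in B) (`[< Q j >]%:R : R))%R.
Proof. by move=> fPQ; rewrite !fsum_indicator (reindex_fsbig _ _ _ _ fPQ). Qed.

Lemma set_bij_setI (I J : Type) (A P : set I) (B Q : set J) (f : I -> J) :
    set_bij A B f -> (forall x, A x -> P x <-> Q (f x)) ->
  set_bij (A `&` P) (B `&` Q) f.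
Proof.
move=> [fAB f_inj f_surj] PQ; split.
- by move=> x [Ax Px]; split; [exact: fAB|apply/PQ].
- by move=> x y; rewrite !inE => -[Ax _] [Ay _]; apply: f_inj; rewrite inE.
- move=> y [By Qy]; have [x Ax fx] := f_surj _ By; exists x => //.
  by split=> //; apply/PQ; rewrite ?fx.
Qed.

Lemma card_fset_set_bij (I J : choiceType) (A : set I) (B : set J)
    (f : I -> J) : finite_set A -> set_bij A B f ->
  #|` fset_set A|%fset = #|` fset_set B|%fset.
Proof.
move=> /finite_setP[n An] [fAB f_inj f_surj]; rewrite (card_fset_set An).
have <- : f @` A = B by apply/seteqP; split=> // _ [x Ax <-]; apply: fAB.
by apply/esym/card_fset_set; apply: card_eq_trans An; apply: inj_card_eq.
Qed.

Lemma psum_fibers (I J : choiceType) (f : I -> J) (X : set I) (A : set J)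
    (F : I -> fps) : summable X F -> X `<=` f @^-1` A ->
  psum X F = psum A (fun j => psum (X `&` f @^-1` [set j]) F).
Proof.
by move=> sumF XA; apply/funext => m; apply: fsbig_fibers => //; apply: sumF.
Qed.

Lemma psum_const (I : choiceType) (X : set I) (F : fps) :
  finite_set X -> psum X (fun=> F) = (F *+ #|` fset_set X|%fset)%R.
Proof.
by move=> finX; apply/funext => m; rewrite /psum fsum_const // natmulfctE.
Qed.

Lemma psum_reindex (I J : choiceType) (f : I -> J) (A : set I) (B : set J)
    (F : J -> fps) : set_bij A B f -> psum B F = psum A (F \o f).
Proof. by move=> fAB; apply/funext => m; apply: reindex_fsbig. Qed.

Lemma eq_psum (I : choiceType) (A : set I) (F G : I -> fps) :
  (forall i, A i -> F i = G i) -> psum A F = psum A G.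
Proof.
by move=> FG; apply/funext => m; apply: eq_fsbigr => i; rewrite inE => /FG ->.
Qed.

(** * Sequences *)

Lemma foldl_addn (x : nat) (s : seq nat) : foldl addn x s = x + sumn s.
Proof. by elim: s x => [|y s IHs] x /=; rewrite ?addn0 // IHs addnA. Qed.

Lemma nth_gt0_size (r : seq nat) (k : nat) : 0 < nth 0 r k -> k < size r.
Proof. by apply: contraTT; rewrite -leqNgt => /(nth_default 0) ->. Qed.

Lemma nth_gt0 (r : seq nat) (k : nat) :
  all (leq 1) r -> (0 < nth 0 r k) = (k < size r).
Proof.
move=> r0; have [kr|rk] := ltnP k (size r); last by rewrite nth_default.
exact: (all_nthP 0 r0).
Qed.

Lemma all_nth (T : Type) (x0 : T) (P : pred T) (s : seq T) (i : nat) :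
  P x0 -> all P s -> P (nth x0 s i).
Proof.
move=> P0 /(all_nthP x0) Ps.
by have [is_|si] := ltnP i (size s); [apply: Ps|rewrite nth_default].
Qed.

Lemma size_nth_lt (K : Type) (ss : seq (seq K)) (i k : nat) :
  k < size (nth [::] ss i) -> i < size ss.
Proof. by apply: contraTT; rewrite -!leqNgt => /(nth_default [::]) ->. Qed.

Lemma sorted_geqP (r : seq nat) :
  reflect (forall k, nth 0 r k.+1 <= nth 0 r k) (sorted geq r).
Proof.
apply: (iffP (sortedP 0)) => decr k; last by move=> _; apply: decr.
by have [kr|rk] := ltnP k.+1 (size r); [apply: decr|rewrite nth_default].
Qed.

Lemma map_index_uniq (K : eqType) (s : seq K) : uniq s ->
  [seq (index x s).+1 | x <- s] = iota 1 (size s).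
Proof.
case: s => // x s us; apply: (@eq_from_nth _ 0).
  by rewrite size_map size_iota.
by rewrite size_map => i i_s; rewrite (nth_map x) // index_uniq // nth_iota.
Qed.

Lemma index_sort_lt (d : Order.disp_t) (K : orderType d) (s : seq K) : uniq s ->
  {in s &, {mono index^~ (sort <=%O s)%O : x y / (x < y)%O >-> x < y}}.
Proof.
rewrite -sort_lt_sorted => s_lt x y xs ys /=.
have index_lt z : z \in s -> index z (sort <=%O s)%O < size (sort <=%O s)%O.
  by rewrite index_mem mem_sort.
have := lt_sorted_ltn_nth x s_lt (index_lt x xs) (index_lt y ys).
by rewrite !nth_index ?mem_sort.
Qed.

Lemma sorted_map_iota (K : Type) (e : rel K) (f : nat -> K) (m n : nat) :
  sorted e [seq f i | i <- iota m n] =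
  all (fun i => e (f i) (f i.+1)) (iota m n.-1).
Proof. by elim: n m => //= -[|n] IHn m //=; rewrite -IHn. Qed.

Lemma perm_sort_leq (s w : seq nat) :
  perm_eq s w -> sorted leq w -> sort leq s = w.
Proof.
move=> sw w_le; apply: (sorted_eq leq_trans anti_leq) => //.
  exact/sort_sorted/leq_total.
by rewrite perm_sort.
Qed.

Lemma sorted_tally_seq (bs : seq (nat * nat)) :
  sorted ltn (unzip1 bs) -> sorted leq (tally_seq bs).
Proof.
rewrite (sorted_pairwise ltn_trans) (sorted_pairwise leq_trans).
elim: bs => [//|[x q] bs IHbs] /= /andP[x_bs s_bs].
rewrite /tally_seq /= pairwise_cat -/(tally_seq bs) IHbs // andbT.
apply/andP; split.
  apply/allrelP => y z; rewrite mem_nseq => /andP[_ /eqP ->].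
  move=> /flattenP[_ /mapP[b b_bs ->]]; rewrite mem_nseq => /andP[_ /eqP ->].
  exact/ltnW/(allP x_bs)/map_f.
by elim: q => //= q ->; rewrite all_nseq leqnn orbT.
Qed.

(** * Coarsenings and partial sums *)

Definition partial_sums : seq nat -> seq nat := scanl addn 0.

Lemma partial_sumsP (s : seq nat) (x : nat) :
  reflect (exists b c, [/\ b != [::], b ++ c = s & sumn b = x])
          (x \in partial_sums s).
Proof.
apply: (iffP (nthP 0)); rewrite size_scanl => -[].
  move=> k ks <-; exists (take k.+1 s), (drop k.+1 s).
  rewrite cat_take_drop nth_scanl // foldl_addn add0n; split=> //.
  by case: s ks.
move=> b [c [b0 <- <-]]; have sb : 0 < size b by rewrite lt0n size_eq0.
exists (size b).-1; first by rewrite size_cat prednK ?leq_addr.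
by rewrite nth_scanl ?size_cat prednK ?leq_addr // take_size_cat // foldl_addn.
Qed.

Lemma partial_sums_cat (s t : seq nat) :
  partial_sums (s ++ t) =
  partial_sums s ++ map (addn (sumn s)) (partial_sums t).
Proof.
rewrite /partial_sums scanl_cat foldl_addn add0n; congr (_ ++ _).
rewrite -[sumn s in LHS]addn0; elim: t 0 => //= x t IHt y.
by rewrite -addnA IHt.
Qed.

Lemma partial_sums_cons (x : nat) (s : seq nat) :
  partial_sums (x :: s) = x :: map (addn x) (partial_sums s).
Proof. by rewrite -cat1s partial_sums_cat /= addn0. Qed.

Lemma partial_sums_gt0 (s : seq nat) :
  is_composition s -> {in partial_sums s, forall x, 0 < x}.
Proof.
move=> cs x /partial_sumsP[[|y b] [c [//= _ bcs <-]]]; move: cs.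
by rewrite -bcs => /= /andP[y0 _]; rewrite addn_gt0 y0.
Qed.

Lemma sumn_partial_sums (s : seq nat) : s != [::] -> sumn s \in partial_sums s.
Proof. by move=> s0; apply/partial_sumsP; exists s, [::]; rewrite cats0. Qed.

Lemma partial_sums_flatten (bs : seq (seq nat)) : [::] \notin bs ->
  {subset partial_sums (map sumn bs) <= partial_sums (flatten bs)}.
Proof.
elim: bs => // b bs IHbs; rewrite in_cons negb_or eq_sym => /andP[b0 nbs] x.
rewrite [map _ _]/= [flatten _]/= partial_sums_cons partial_sums_cat.
rewrite in_cons mem_cat => /orP[/eqP ->|/mapP[y /(IHbs nbs) yb ->]].
  by rewrite sumn_partial_sums.
by rewrite map_f ?orbT.
Qed.

Lemma partial_sums_sub_coarsening (a b : seq nat) :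
    is_composition a -> is_composition b -> sumn a = sumn b ->
  {subset partial_sums a <= partial_sums b} -> coarsening a b.
Proof.
elim: a b => [|x a IHa] b.
  move=> _ cb sb _; exists [::]; split=> //.
  by case: b cb sb => // -[|y] b.
move=> /andP[x0 ca] cb sab sub.
have /partial_sumsP[b1 [b2 [b1n0 eb1 eb2]]] : x \in partial_sums b.
  by apply: sub; rewrite partial_sums_cons mem_head.
subst b x; move: cb; rewrite /is_composition all_cat => /andP[_ cb2].
have [||bs [nbs bsb bsa]] := IHa b2 ca cb2.
- by move: sab; rewrite /= sumn_cat => /addnI.
- move=> y ya; have y0 := partial_sums_gt0 ca ya.
  have: sumn b1 + y \in partial_sums (b1 ++ b2).
    by apply: sub; rewrite partial_sums_cons in_cons (map_f _ ya) orbT.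
  rewrite partial_sums_cat mem_cat => /orP[/partial_sumsP|].
    by move=> [c [d [_ <-]]]; rewrite sumn_cat; lia.
  by move=> /mapP[z zb2 /addnI ->].
exists (b1 :: bs); split; rewrite /= ?bsb ?bsa //.
by rewrite in_cons negb_or nbs eq_sym b1n0.
Qed.

Lemma coarseningP (a b : seq nat) : is_composition a -> is_composition b ->
  coarsening a b <->
  sumn a = sumn b /\ {subset partial_sums a <= partial_sums b}.
Proof.
move=> ca cb; split=> [[bs [nbs <- <-]]|[]].
  by split; [rewrite sumn_flatten|apply: partial_sums_flatten].
exact: partial_sums_sub_coarsening.
Qed.

(** * Coefficients of fundamental quasisymmetric functions *)

Definition exponent_tally (m : monomial) : seq (nat * nat) :=
  [seq (x, m x) | x <- sort leq (undup m)].

Definition exponents (m : monomial) : seq nat := unzip2 (exponent_tally m).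

Lemma unzip1_exponent_tally (m : monomial) :
  unzip1 (exponent_tally m) = sort leq (undup m).
Proof. by rewrite /unzip1 -map_comp map_id. Qed.

Lemma sorted_exponent_tally (m : monomial) :
  sorted ltn (unzip1 (exponent_tally m)).
Proof.
rewrite unzip1_exponent_tally ltn_sorted_uniq_leq sort_uniq undup_uniq.
exact/sort_sorted/leq_total.
Qed.

Lemma exponents_composition (m : monomial) : is_composition (exponents m).
Proof.
apply/allP => _ /mapP[_ /mapP[x xm ->] ->] /=.
by rewrite -in_mset -mem_undup -(mem_sort leq).
Qed.

Lemma wf_tally_composition (bs : seq (nat * nat)) :
  sorted ltn (unzip1 bs) -> is_composition (unzip2 bs) -> bs \is a wf_tally nat.
Proof.
move=> s_bs c_bs; rewrite qualifE /= (sorted_uniq ltn_trans ltnn s_bs).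
by apply/negP => /(allP c_bs).
Qed.

Lemma perm_exponent_tally (m : monomial) :
  perm_eq m (tally_seq (exponent_tally m)).
Proof.
apply: perm_trans (perm_tally_seq _); first by rewrite perm_sym; apply: tallyK.
apply: perm_trans (tallyE _) _; under eq_map do rewrite count_mem_mset.
by apply: perm_map; rewrite perm_sym perm_sort.
Qed.

Lemma sort_exponent_tally (m : monomial) :
  sort leq m = tally_seq (exponent_tally m).
Proof.
apply: perm_sort_leq (perm_exponent_tally m) _.
exact/sorted_tally_seq/sorted_exponent_tally.
Qed.

Lemma sumn_exponents (m : monomial) : sumn (exponents m) = size m.
Proof. by rewrite -size_tally_seq -sort_exponent_tally size_sort. Qed.

Lemma exponent_tally_tally_seq (bs : seq (nat * nat)) :
    sorted ltn (unzip1 bs) -> is_composition (unzip2 bs) ->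
  exponent_tally (seq_mset (tally_seq bs)) = bs.
Proof.
move=> s_bs c_bs; set m := seq_mset _.
have wf_m : exponent_tally m \is a wf_tally nat.
  by rewrite wf_tally_composition ?sorted_exponent_tally ?exponents_composition.
rewrite -(tally_seqK wf_m) -[RHS](tally_seqK (wf_tally_composition s_bs c_bs)).
congr tally; rewrite -sort_exponent_tally.
exact: perm_sort_leq (perm_eq_seq_mset _) (sorted_tally_seq s_bs).
Qed.

Lemma M_termE (c i : seq nat) : M_term c i = seq_mset (tally_seq (zip i c)).
Proof.
apply/msetP => x; rewrite /M_term /tally_seq mset_seqE.
elim: (zip i c) => [|[y q] bs IHbs] /=; first by rewrite big_nil mset0E.
rewrite big_cons count_cat -IHbs msetE2 msetnE count_nseq /= eq_sym.
by case: eqP; rewrite ?mul1n.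
Qed.

Lemma M_term_eqP (c i : seq nat) (m : monomial) : is_composition c ->
    size i = size c -> sorted ltn i ->
  m = M_term c i <-> i = unzip1 (exponent_tally m) /\ c = exponents m.
Proof.
move=> cc ic si; rewrite M_termE; split=> [->|[-> ->]].
  by rewrite /exponents exponent_tally_tally_seq ?unzip1_zip ?unzip2_zip ?ic.
rewrite zip_unzip -[LHS]seq_mset_id; apply/eq_seq_msetP.
exact: perm_exponent_tally.
Qed.

Lemma qsym_M_coef (c : seq nat) (m : monomial) : is_composition c ->
  qsym_M c m = ((0 \notin m) && (c == exponents m))%:R%R.
Proof.
move=> cc; have [/andP[m0 /eqP cE]|ncm] := boolP (_ && _).
  have ic : size (unzip1 (exponent_tally m)) = size c by rewrite cE !size_map.
  have si := sorted_exponent_tally m.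
  rewrite [LHS](fsbig_only1 (unzip1 (exponent_tally m))) => [||i].
  - by rewrite /mono -((M_term_eqP m cc ic si).2 (conj erefl cE)) eqxx.
  - split=> //; rewrite unzip1_exponent_tally; apply/allP => x.
    by rewrite mem_sort mem_undup lt0n; apply: contraTneq => ->.
  - by move=> [i_c _ s_i] ni; rewrite /mono; case: eqP => // /M_term_eqP[].
apply: fsbig1 => i [ic i0 si]; rewrite /mono; case: eqP => // mE.
have [iE cE] := (M_term_eqP m cc ic si).1 mE; case/negP: ncm.
rewrite -cE eqxx andbT -mem_undup -(mem_sort leq) -unzip1_exponent_tally -iE.
by apply/negP => /(allP i0).
Qed.

Definition qsym_F_supp (b : seq nat) (m : monomial) : Prop :=
  0 \notin m /\ coarsening b (exponents m).

Lemma qsym_F_coef (b : seq nat) (m : monomial) :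
  qsym_F b m = `[< qsym_F_supp b m >]%:R%R.
Proof.
have cm := exponents_composition m.
rewrite asbool_and asboolb; have [bm|nbm] := asboolP (coarsening _ _).
  rewrite andbT -[_ \notin _]andbT -[true](eqxx (exponents m)) -qsym_M_coef //.
  apply: (fsbig_only1 (exponents m)) => [|c [cc _] nc]; first by split.
  by rewrite qsym_M_coef // andbC; case: eqP.
rewrite andbF; apply: fsbig1 => c [cc bc]; rewrite qsym_M_coef //.
by case: eqP => [cE|]; rewrite ?andbF //; case: nbm; rewrite -cE.
Qed.

Lemma mem_partial_sums_tally (bs : seq (nat * nat)) (p : nat) :
    sorted ltn (unzip1 bs) -> is_composition (unzip2 bs) ->
    0 < p < sumn (unzip2 bs) ->
  (p \in partial_sums (unzip2 bs)) =
  (nth 0 (tally_seq bs) p.-1 < nth 0 (tally_seq bs) p).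
Proof.
rewrite (sorted_pairwise ltn_trans).
elim: bs p => [|[x q] bs IHbs] p /=; first by rewrite ltn0 andbF.
move=> /andP[x_bs s_bs] /andP[q0 c_bs] /andP[p0 p_bs].
rewrite partial_sums_cons in_cons /tally_seq /= -/(tally_seq bs).
rewrite !nth_cat !size_nseq; have [pq|qp|epq] := ltngtP p q.
- have p'q : p.-1 < q := leq_ltn_trans (leq_pred p) pq.
  rewrite p'q !nth_nseq pq p'q ltnn; apply/negbTE/mapP => -[z _ ez].
  by rewrite ez ltnNge leq_addr in pq.
- have -> : (p.-1 < q) = false by lia.
  have -> : p.-1 - q = (p - q).-1 by lia.
  rewrite -IHbs //; last by lia.
  by rewrite -{1}(subnKC (ltnW qp)) mem_map //; apply: addnI.
- subst p; apply/esym.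
  rewrite subnn prednK // leqnn nth_nseq prednK // leqnn /=.
  have /(mem_nth 0)/flattenP[_ /mapP[b b_bs ->]] : 0 < size (tally_seq bs).
    by rewrite size_tally_seq; move: p_bs; rewrite -{1}[q]addn0 ltn_add2l.
  by rewrite mem_nseq => /andP[_ /eqP ->]; apply/(allP x_bs)/map_f.
Qed.

(** * Rows of semi-standard augmented fillings *)

(* The triple condition of ComTs for a row [r] above a row [r'], both padded
   with zeros; once the basement is added to the rows, it is also what the type
   A and type B conditions amount to. *)
Definition triple_rule (r r' : seq nat) : bool :=
  all (fun k => (0 < nth 0 r' k.+1) && (nth 0 r k.+1 <= nth 0 r' k.+1) ==>
                (nth 0 r k < nth 0 r' k.+1))
      (iota 0 (size r')).

Lemma triple_ruleP (r r' : seq nat) :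
  reflect (forall k, 0 < nth 0 r' k.+1 -> nth 0 r k.+1 <= nth 0 r' k.+1 ->
             nth 0 r k < nth 0 r' k.+1)
          (triple_rule r r').
Proof.
apply: (iffP allP) => [rule k r'k le_k|rule k _]; last first.
  by apply/implyP => /andP[r'k le_k]; apply: rule.
by have := rule k; rewrite r'k le_k mem_iota; apply; apply/ltnW/nth_gt0_size.
Qed.

Lemma triple_rule0l (r : seq nat) : triple_rule [::] r.
Proof. by apply/triple_ruleP => k rk; rewrite !nth_nil. Qed.

Lemma triple_rule0r (r : seq nat) : triple_rule r [::].
Proof. by []. Qed.

Lemma triple_rule_nth_neq (r r' : seq nat) (k : nat) : sorted geq r ->
  triple_rule r r' -> nth 0 r 0 != nth 0 r' 0 -> 0 < nth 0 r' k ->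
  nth 0 r k != nth 0 r' k.
Proof.
move=> /sorted_geqP dec_r /triple_ruleP rule neq0; case: k => // k r'k.
by apply/eqP => eqk; have := rule k r'k; have := dec_r k; lia.
Qed.

Lemma triple_rule_nth_neqS (r r' : seq nat) (k : nat) : sorted geq r ->
  triple_rule r r' -> 0 < nth 0 r' k.+1 -> nth 0 r k != nth 0 r' k.+1.
Proof.
move=> /sorted_geqP dec_r /triple_ruleP rule r'k.
by have := rule k r'k; have := dec_r k; lia.
Qed.

Lemma triple_rule_longer (r r' : seq nat) (k : nat) : sorted geq r' ->
  all (leq 1) r' -> size r < size r' -> triple_rule r r' -> k < size r ->
  nth 0 r k < nth 0 r' k.+1.
Proof.
move=> /sorted_geqP dec_r' pos_r' s_rr' /triple_ruleP rule kr.
have r'_gt0 l : l < size r -> 0 < nth 0 r' l.+1.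
  by move=> lr; rewrite nth_gt0 //; lia.
have [d ed] : exists d, k + d = (size r).-1 by exists ((size r).-1 - k); lia.
elim: d k kr ed => [|d IHd] k kr ed; apply: rule; rewrite ?r'_gt0 //.
  by rewrite nth_default //; lia.
by apply: leq_trans (dec_r' _); apply/ltnW/IHd; lia.
Qed.

Lemma longer_triple_rule (r r' : seq nat) : sorted geq r -> sorted geq r' ->
    nth 0 r 0 < nth 0 r' 0 ->
    (forall k, k < size r -> k.+1 < size r' -> nth 0 r k <= nth 0 r' k ->
       nth 0 r k < nth 0 r' k.+1) ->
  triple_rule r r'.
Proof.
move=> /sorted_geqP dec_r /sorted_geqP dec_r' lt0 lt_shift.
apply/triple_ruleP => k r'k _.
have lt_nthS l : 0 < nth 0 r' l.+1 -> nth 0 r l < nth 0 r' l ->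
    nth 0 r l < nth 0 r' l.+1.
  move=> r'l /ltnW le_l; have [lr|rl] := ltnP l (size r).
    by apply: lt_shift => //; apply: nth_gt0_size.
  by rewrite nth_default.
elim: k r'k => [|k IHk] r'k; first exact: lt_nthS.
apply: lt_nthS => //; apply: leq_ltn_trans (dec_r k) _; apply: IHk.
exact: leq_trans r'k (dec_r' _).
Qed.

Lemma part_shape (T : filling) (i : nat) :
  part (shape T) i = size (nth [::] T i.-1).
Proof.
rewrite /part; have [iT|iT] := ltnP i.-1 (size T).
  by rewrite (nth_map [::]).
by rewrite !nth_default ?size_map.
Qed.

Definition aug_row (T : filling) (i : nat) : seq nat := i :: nth [::] T i.-1.

Lemma aug_entryE (T : filling) (i k : nat) :
  aug_entry T (i, k) = nth 0 (aug_row T i) k.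
Proof. by case: k. Qed.

Lemma in_aug_diagramE (T : filling) (i k : nat) :
  in_aug_diagram (shape T) (i, k) =
  (0 < i <= size T) && (k < size (aug_row T i)).
Proof. by rewrite /in_aug_diagram /= part_shape size_map. Qed.

Lemma cell_lt_right (T : filling) (i j k l : nat) : k < l ->
  cell_lt T (i, k) (j, l) = (aug_entry T (i, k) < aug_entry T (j, l)).
Proof. by move=> kl; rewrite /cell_lt /read_before /=; lia. Qed.

Lemma cell_lt_left (T : filling) (i j k l : nat) : l < k ->
  cell_lt T (i, k) (j, l) = (aug_entry T (i, k) <= aug_entry T (j, l)).
Proof. by move=> kl; rewrite /cell_lt /read_before /=; lia. Qed.

Lemma cell_lt_above (T : filling) (i j k : nat) : i < j ->
  cell_lt T (j, k) (i, k) = (aug_entry T (j, k) < aug_entry T (i, k)).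
Proof. by move=> ij; rewrite /cell_lt /read_before /=; lia. Qed.

Lemma type_A_inversionE (T : filling) (i j k : nat) : i < j ->
    aug_entry T (i, k.+1) <= aug_entry T (i, k) ->
  inversion_triple T (i, k.+1) (j, k.+1) (i, k) =
  (aug_entry T (i, k.+1) <= aug_entry T (j, k.+1)) ==>
  (aug_entry T (i, k) < aug_entry T (j, k.+1)).
Proof.
move=> ij dec_i; rewrite /inversion_triple cell_lt_left // cell_lt_right //.
by rewrite cell_lt_above //; lia.
Qed.

Lemma type_B_inversionE (T : filling) (i j k : nat) : i < j ->
    aug_entry T (j, k.+1) <= aug_entry T (j, k) ->
  inversion_triple T (i, k) (j, k) (j, k.+1) =
  (aug_entry T (i, k) <= aug_entry T (j, k)) ==>
  (aug_entry T (i, k) < aug_entry T (j, k.+1)).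
Proof.
move=> ij dec_j; rewrite /inversion_triple cell_lt_right // cell_lt_left //.
by rewrite cell_lt_above //; lia.
Qed.

Section TripleRuleSSAF.

Variable T : filling.
Hypotheses (posT : positive_entries T)
  (decT : forall i, 0 < i <= size T -> sorted geq (aug_row T i))
  (ruleT : forall i j, 0 < i < j -> j <= size T ->
             triple_rule (aug_row T i) (aug_row T j)).

Let posT_row (i : nat) : 0 < i -> all (leq 1) (aug_row T i).
Proof. by move=> i0; rewrite /= i0 all_nth. Qed.

Lemma triple_rule_non_attacking : non_attacking (shape T) T.
Proof.
have column_neq i j k : 0 < i < j -> j <= size T -> k < size (aug_row T j) ->
    nth 0 (aug_row T i) k != nth 0 (aug_row T j) k.
  move=> ij jT kj; have iT : 0 < i <= size T by lia.
  have [i_neq_j j0] : i != j /\ 0 < j by lia.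
  apply: triple_rule_nth_neq (decT iT) (ruleT ij jT) i_neq_j _.
  by rewrite nth_gt0 ?posT_row.
move=> [i k] [j l]; rewrite !in_aug_diagramE !aug_entryE xpair_eqE /attack /=.
move=> /andP[/andP[i0 iT] ki] /andP[/andP[j0 jT] lj] neq.
move=> /orP[/eqP ekl|/andP[/eqP ekl ji]]; subst.
  rewrite eqxx andbT in neq.
  have [ij|ji|eij] := ltngtP i j; last by rewrite eij eqxx in neq.
    by apply: column_neq; rewrite ?i0.
  by rewrite eq_sym; apply: column_neq; rewrite ?j0.
rewrite eq_sym; apply: triple_rule_nth_neqS.
- by apply: decT; rewrite j0 ltnW // (leq_trans ji).
- by apply: ruleT; rewrite ?j0.
- by rewrite nth_gt0 ?posT_row.
Qed.

Lemma triple_rule_type_A_ok : type_A_ok (shape T) T.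
Proof.
move=> i j [|k] // i0 ij _ _; rewrite !in_aug_diagramE => /andP[/andP[_ iT] _].
move=> /andP[/andP[j0 jT] kj]; have ijP : 0 < i < j by rewrite i0.
rewrite type_A_inversionE // !aug_entryE.
  apply/implyP; apply: triple_ruleP (ruleT ijP jT) _ _.
  by rewrite nth_gt0 ?posT_row.
by apply/sorted_geqP/decT; rewrite i0.
Qed.

Lemma triple_rule_type_B_ok : type_B_ok (shape T) T.
Proof.
move=> i j k i0 ij; rewrite !part_shape !in_aug_diagramE => s_ij.
move=> /andP[/andP[_ iT] ki] /andP[/andP[j0 jT] kj].
have dec_j : sorted geq (aug_row T j) by apply: decT; rewrite j0.
rewrite type_B_inversionE // !aug_entryE; last exact: sorted_geqP dec_j _.
apply/implyP => _; apply: triple_rule_longer => //; first exact: posT_row.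
by apply: ruleT; rewrite ?i0.
Qed.

Lemma triple_rule_SSAF : SSAF (shape T) T.
Proof.
split; split=> //.
- exact: triple_rule_non_attacking.
- move=> i k; rewrite in_aug_diagramE => /andP[iT _]; rewrite !aug_entryE.
  exact/sorted_geqP/decT.
- exact: triple_rule_type_A_ok.
- exact: triple_rule_type_B_ok.
Qed.

End TripleRuleSSAF.

Lemma SSAF_sorted_aug_row (T : filling) (i : nat) : SSAF (shape T) T ->
  0 < i <= size T -> sorted geq (aug_row T i).
Proof.
move=> [_ [decT _ _]] iT; apply/(sortedP 0) => k ki.
by have := decT i k; rewrite in_aug_diagramE iT ki !aug_entryE; apply.
Qed.

Lemma SSAF_triple_rule (T : filling) (i j : nat) : SSAF (shape T) T ->
  0 < i < j -> j <= size T -> triple_rule (aug_row T i) (aug_row T j).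
Proof.
move=> ssafT /andP[i0 ij] jT; have [_ [_ typeA typeB]] := ssafT.
have iT : 0 < i <= size T by rewrite i0 ltnW // (leq_trans ij).
have jTP : 0 < j <= size T by rewrite (ltn_trans i0).
have dec_i := SSAF_sorted_aug_row ssafT iT.
have dec_j := SSAF_sorted_aug_row ssafT jTP.
have [s_ij|s_ji] := ltnP (size (aug_row T i)) (size (aug_row T j)).
  apply: longer_triple_rule => // k ki kj le_ij.
  have := typeB i j k i0 ij; rewrite !part_shape !in_aug_diagramE iT jTP.
  move=> /(_ s_ij ki kj); rewrite type_B_inversionE // !aug_entryE ?le_ij //.
  exact: sorted_geqP dec_j _.
apply/triple_ruleP => k /nth_gt0_size kj le_ij.
have := typeA i j k.+1 i0 ij isT; rewrite !part_shape !in_aug_diagramE iT jTP.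
move=> /(_ s_ji (leq_trans kj s_ji) kj).
rewrite type_A_inversionE // !aug_entryE ?le_ij //.
exact: sorted_geqP dec_i _.
Qed.

Lemma triple_rule_cons (i j : nat) (r r' : seq nat) :
    (0 < nth 0 r' 0 -> i < nth 0 r' 0) ->
  triple_rule (i :: r) (j :: r') = triple_rule r r'.
Proof.
move=> lt_i; apply/triple_ruleP/triple_ruleP => rule k.
  exact: (rule k.+1).
by case: k => [r'0 _|k]; [apply: lt_i|apply: rule].
Qed.

Fixpoint starts_in_basement (n : nat) (T : filling) : bool :=
  if T is r :: T' then
    ((r == [::]) || (nth 0 r 0 == n.+1)) && starts_in_basement n.+1 T'
  else true.

Lemma starts_in_basementP (n : nat) (T : filling) :
  reflect (forall i, nth [::] T i != [::] ->
             nth 0 (nth [::] T i) 0 = (n + i).+1)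
          (starts_in_basement n T).
Proof.
elim: T n => [|r T IHT] n /=; first by constructor=> i; rewrite nth_nil.
apply: (iffP andP) => [[r_n /IHT startsT] [|i] /= r0|starts].
- by rewrite addn0; case/orP: r_n => /eqP // r_nil; rewrite r_nil in r0.
- by rewrite -addSnnS startsT.
- split; last by apply/IHT => i; rewrite addSnnS; apply: (starts i.+1).
  by have [->//|r0] := eqVneq r [::]; rewrite (starts 0 r0) addn0 eqxx.
Qed.

Lemma starts_in_basement_nth (n i : nat) (T : filling) :
  starts_in_basement n T -> 0 < nth 0 (nth [::] T i) 0 ->
  nth 0 (nth [::] T i) 0 = (n + i).+1.
Proof.
move=> /starts_in_basementP startsT Ti; apply: startsT.
by apply: contraTneq Ti => ->.
Qed.

Lemma SSAF_starts_in_basement (T : filling) :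
  SSAF (shape T) T -> starts_in_basement 0 T.
Proof.
move=> ssafT; apply/starts_in_basementP => i; rewrite -size_eq0 -lt0n => Ti.
apply: (SSAF_col1 ssafT (i := i.+1)); rewrite ?part_shape // size_map.
exact: size_nth_lt Ti.
Qed.

Lemma SSAFP (T : filling) :
  SSAF (shape T) T <-> [/\ positive_entries T, all (sorted geq) T,
                          starts_in_basement 0 T & pairwise triple_rule T].
Proof.
split=> [ssafT|[posT decT startsT ruleT]].
  have [[_ posT _] _] := ssafT; have startsT := SSAF_starts_in_basement ssafT.
  split=> //.
    apply/(all_nthP [::]) => i iT.
    exact: path_sorted (SSAF_sorted_aug_row (i := i.+1) ssafT iT).
  apply/(pairwiseP [::]) => i j; rewrite !inE => iT jT ij.
  rewrite -(triple_rule_cons (i := i.+1) j.+1); first exact: SSAF_triple_rule.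
  by move=> /(starts_in_basement_nth startsT) ->.
apply: triple_rule_SSAF => // [[|i] // iT|[|i] [|j] // ij jT].
  rewrite /aug_row /=; have := all_nth (x0 := [::]) i isT decT.
  have := starts_in_basementP _ _ startsT i.
  by case: (nth _ T i) => //= x r -> //; rewrite leqnn.
rewrite triple_rule_cons; last by move=> /(starts_in_basement_nth startsT) ->.
by apply: (pairwiseP [::] ruleT); rewrite ?inE //; lia.
Qed.

(** * Deleting the empty rows *)

Definition head_lt (r r' : seq nat) : bool := nth 0 r 0 < nth 0 r' 0.

Lemma ComTP (a : seq nat) (U : filling) :
  ComT a U <-> [/\ shape U = a, positive_entries U, all (sorted geq) U,
                   pairwise head_lt U & pairwise triple_rule U].
Proof.
split=> -[Ua posU decU headU ruleU]; split=> //.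
- apply/(pairwiseP [::]) => i j; rewrite !inE => iU jU ij.
  by apply: (headU i.+1 j.+1); rewrite // -Ua size_map.
- apply/(pairwiseP [::]) => i j; rewrite !inE => iU jU ij.
  apply/triple_ruleP => k Ujk.
  apply: (ruleU i.+1 j.+1 k.+2) => //; rewrite -?lt0n // -Ua ?size_map //.
  apply: leq_trans (nth_gt0_size Ujk) _.
  by apply: leq_bigmax_seq => //; apply/map_f/mem_nth.
- move=> [|i] [|j] // _ ij; rewrite -Ua size_map => jU.
  by apply: (pairwiseP [::] headU); rewrite ?inE //; lia.
- move=> [|i] [|j] [|[|k]] // _ ij; rewrite -Ua size_map => jU _ Ujk le_ij.
  have /triple_ruleP rule : triple_rule (nth [::] U i) (nth [::] U j).
    by apply: (pairwiseP [::] ruleU); rewrite ?inE //; lia.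
  by apply: rule; rewrite ?lt0n.
Qed.

Definition drop_empty (T : filling) : filling := [seq r <- T | r != [::]].

(* Each row goes to the height given by its first entry; the first [n] heights
   are left out. *)
Fixpoint insert_empty (n : nat) (U : filling) : filling :=
  if U is r :: U' then
    nseq (nth 0 r 0 - n.+1) [::] ++ r :: insert_empty (nth 0 r 0) U'
  else [::].

Lemma shape_drop_empty (T : filling) :
  shape (drop_empty T) = compress (shape T).
Proof. by elim: T => //= -[|x r] T //= ->. Qed.

Lemma flatten_drop_empty (T : filling) : flatten (drop_empty T) = flatten T.
Proof. by elim: T => //= -[|x r] T //= ->. Qed.

Lemma content_drop_empty (T : filling) : content (drop_empty T) = content T.
Proof. by rewrite /content flatten_drop_empty. Qed.

Lemma column_drop_empty (T : filling) (v : nat) :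
  column (drop_empty T) v = column T v.
Proof.
by rewrite /column; congr _.+1; elim: T => //= -[|x r] T IHT //=; case: ifP.
Qed.

Lemma descent_composition_drop_empty (T : filling) :
  descent_composition (drop_empty T) = descent_composition T.
Proof.
rewrite /descent_composition /descents flatten_drop_empty; congr beta.
by apply: eq_filter => i; rewrite !column_drop_empty.
Qed.

Lemma all_drop_empty (P : pred (seq nat)) (T : filling) :
  P [::] -> all P (drop_empty T) = all P T.
Proof. by move=> P0; elim: T => //= -[|x r] T /= ->; rewrite ?P0. Qed.

Lemma pairwise_drop_empty (R : rel (seq nat)) (T : filling) :
    (forall r, R [::] r) -> (forall r, R r [::]) ->
  pairwise R (drop_empty T) = pairwise R T.
Proof.
move=> R0l R0r; elim: T => //= -[|x r] T /= ->; last by rewrite all_drop_empty.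
by rewrite (eq_all (R0l : _ =1 predT)) all_predT.
Qed.

Lemma starts_in_basement_gt (n : nat) (T : filling) :
  starts_in_basement n T -> all (fun r => n < nth 0 r 0) (drop_empty T).
Proof.
elim: T n => //= r T IHT n /andP[r_n /IHT gtT].
have {}gtT : all (fun r => n < nth 0 r 0) (drop_empty T).
  by apply: sub_all gtT => s /ltnW.
by case: eqP r_n => //= _ /eqP ->; rewrite leqnn.
Qed.

Lemma starts_in_basement_head_lt (n : nat) (T : filling) :
  starts_in_basement n T -> pairwise head_lt (drop_empty T).
Proof.
elim: T n => //= r T IHT n /andP[r_n startsT].
case: eqP r_n => [_ _|_ /eqP r_n] /=; first exact: IHT startsT.
by rewrite (IHT _ startsT) andbT /head_lt r_n starts_in_basement_gt.
Qed.

Lemma SSAF_ComT (T : filling) : starts_in_basement 0 T ->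
  SSAF (shape T) T <-> ComT (compress (shape T)) (drop_empty T).
Proof.
have posE : positive_entries (drop_empty T) = positive_entries T.
  exact: all_drop_empty.
move=> startsT; apply: (iff_trans (SSAFP T)); apply: iff_sym.
apply: (iff_trans (ComTP _ _)); rewrite shape_drop_empty posE all_drop_empty //.
rewrite (pairwise_drop_empty T triple_rule0l triple_rule0r).
by rewrite (starts_in_basement_head_lt startsT); split=> -[].
Qed.

Lemma drop_insert_empty (n : nat) (U : filling) :
  [::] \notin U -> drop_empty (insert_empty n U) = U.
Proof.
elim: U n => //= r U IHU n; rewrite in_cons negb_or eq_sym => /andP[r0 U0].
rewrite /drop_empty filter_cat filter_nseq /= r0.
by congr cons; apply: IHU.
Qed.

Lemma insert_empty_nil_cons (n : nat) (U : filling) :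
    U != [::] -> all (fun r => n.+1 < nth 0 r 0) U ->
  insert_empty n U = [::] :: insert_empty n.+1 U.
Proof. by case: U => //= r U _ /andP[r_n _]; rewrite -(subnSK r_n). Qed.

Lemma insert_drop_empty (n : nat) (T : filling) : starts_in_basement n T ->
  0 < last 1 (shape T) -> insert_empty n (drop_empty T) = T.
Proof.
elim: T n => //= r T IHT n /andP[r_n startsT] lastT.
have {}IHT : insert_empty n.+1 (drop_empty T) = T.
  by apply: IHT => //; case: (T) lastT.
case: eqP r_n => [r0 _|_ /eqP r_n] /=; last by rewrite r_n subnn IHT.
rewrite insert_empty_nil_cons ?starts_in_basement_gt // ?IHT ?r0 //.
by apply: contraTneq lastT => dropT; rewrite -IHT dropT /= r0.
Qed.

Lemma last_shape_insert_empty (n x : nat) (U : filling) :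
  [::] \notin U -> 0 < x -> 0 < last x (shape (insert_empty n U)).
Proof.
elim: U n x => //= r U IHU n x.
rewrite in_cons negb_or eq_sym => /andP[r0 U0] _.
by rewrite /shape map_cat last_cat /= IHU // lt0n size_eq0.
Qed.

Lemma starts_in_basement_nseq (n d : nat) (T : filling) :
  starts_in_basement n (nseq d [::] ++ T) = starts_in_basement (n + d) T.
Proof. by elim: d n => [|d IHd] n; rewrite ?addn0 //= IHd addSnnS. Qed.

Lemma starts_in_basement_insert_empty (n : nat) (U : filling) :
  all (fun r => n < nth 0 r 0) U -> pairwise head_lt U ->
  starts_in_basement n (insert_empty n U).
Proof.
elim: U n => //= r U IHU n /andP[r_n _] /andP[rU /(IHU _ rU) startsU].
by rewrite starts_in_basement_nseq /= -addSn subnKC // eqxx orbT.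
Qed.

Lemma SSAF_shape (g : seq nat) (T : filling) : SSAF g T -> shape T = g.
Proof. by case=> -[]. Qed.

Definition SSAFs (a : seq nat) : set filling :=
  [set T | exists2 g, expansion a g & SSAF g T].

Lemma SSAFsP (a : seq nat) (T : filling) :
  SSAFs a T <-> expansion a (shape T) /\ SSAF (shape T) T.
Proof.
split=> [[g ag gT]|[aT ssafT]]; last by exists (shape T).
by rewrite (SSAF_shape gT).
Qed.

Lemma drop_empty_bij (a : seq nat) : is_composition a ->
  set_bij (SSAFs a) (ComT a) drop_empty.
Proof.
move=> ca; split.
- move=> T /SSAFsP[[_ <-] ssafT]; apply/SSAF_ComT => //.
  by have /SSAFP[] := ssafT.
- have dropK : {in SSAFs a, cancel drop_empty (insert_empty 0)}.
    move=> T; rewrite inE => /SSAFsP[[lastT _] /SSAFP[_ _ startsT _]].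
    exact: insert_drop_empty.
  exact: can_in_inj dropK.
- move=> U comU; have /ComTP[Ua posU _ headU _] := comU.
  have U0 : [::] \notin U.
    by apply/negP => /(map_f size); rewrite -/(shape U) Ua => /(allP ca).
  have startsU : starts_in_basement 0 (insert_empty 0 U).
    apply: starts_in_basement_insert_empty => //; apply/allP => r rU.
    rewrite nth_gt0 ?(allP posU) // lt0n size_eq0.
    by apply: contraNneq U0 => <-.
  have dropU := drop_insert_empty 0 U0.
  exists (insert_empty 0 U) => //; apply/SSAFsP.
  have shapeU : compress (shape (insert_empty 0 U)) = a.
    by rewrite -shape_drop_empty dropU.
  split; first by split=> //; apply: last_shape_insert_empty.
  by apply/SSAF_ComT; rewrite ?shapeU ?dropU.
Qed.

(** * Standardization *)

(* The key of a cell is its entry and its column. Equal entries are ordered from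
   right to left so that no descent separates them. *)
Notation std_key := (nat *l nat^d)%type.

Notation key0 := ((0, 0) : std_key).

Definition row_keys (r : seq nat) : seq std_key := zip r (iota 1 (size r)).

Definition keys (T : filling) : seq std_key :=
  flatten [seq row_keys r | r <- T].

Definition relabel (f : std_key -> nat) (T : filling) : filling :=
  [seq [seq f c | c <- row_keys r] | r <- T].

Lemma lt_std_key (c d : std_key) :
  (c < d)%O = (c.1 < d.1) || ((c.1 == d.1) && (d.2 < c.2)).
Proof.
rewrite ltEprodlexi ltEdual !leEnat ltEnat /=.
by case: (ltngtP c.1 d.1).
Qed.

Lemma unzip1_row_keys (r : seq nat) : unzip1 (row_keys r) = r.
Proof. by rewrite unzip1_zip // size_iota. Qed.

Lemma size_row_keys (r : seq nat) : size (row_keys r) = size r.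
Proof. by rewrite size_zip size_iota minnn. Qed.

Lemma nth_row_keys (c : std_key) (r : seq nat) (k : nat) : k < size r ->
  nth c (row_keys r) k = (nth 0 r k, k.+1).
Proof.
move=> kr; rewrite (set_nth_default key0) ?size_row_keys //.
by rewrite nth_zip ?size_iota // nth_iota.
Qed.

Lemma row_keysP (r : seq nat) (c : std_key) :
  reflect (exists2 k, k < size r & c = (nth 0 r k, k.+1)) (c \in row_keys r).
Proof.
apply: (iffP (nthP c)); rewrite size_row_keys => -[k kr]; exists k => //.
  by rewrite -(nth_row_keys c).
by rewrite nth_row_keys.
Qed.

Lemma row_keys_relabel (f : std_key -> nat) (r : seq nat) :
  row_keys [seq f c | c <- row_keys r] =
  [seq (f c, c.2) : std_key | c <- row_keys r].
Proof.
apply: (@eq_from_nth _ key0) => [|k].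
  by rewrite size_map !size_row_keys size_map size_row_keys.
rewrite size_row_keys size_map size_row_keys => kr.
rewrite nth_row_keys ?size_map ?size_row_keys //.
by rewrite !(nth_map key0) ?size_row_keys // nth_row_keys.
Qed.

Lemma keys_relabel (f : std_key -> nat) (T : filling) :
  keys (relabel f T) = [seq (f c, c.2) : std_key | c <- keys T].
Proof.
by elim: T => //= r T IHT; rewrite /keys /= map_cat row_keys_relabel -IHT.
Qed.

Lemma flatten_relabel (f : std_key -> nat) (T : filling) :
  flatten (relabel f T) = [seq f c | c <- keys T].
Proof. by elim: T => //= r T IHT; rewrite /keys /= map_cat -IHT. Qed.

Lemma unzip1_keys (T : filling) : unzip1 (keys T) = flatten T.
Proof.
elim: T => //= r T IHT.
by rewrite /keys /= /unzip1 map_cat -/unzip1 -IHT unzip1_row_keys.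
Qed.

Lemma size_keys (T : filling) : size (keys T) = size (flatten T).
Proof. by rewrite -unzip1_keys size_map. Qed.

Lemma relabel_comp (f g : std_key -> nat) (T : filling) :
  relabel f (relabel g T) = relabel (fun c => f (g c, c.2)) T.
Proof. by elim: T => //= r T ->; rewrite row_keys_relabel -map_comp. Qed.

Lemma relabel_id_in (f : std_key -> nat) (T : filling) :
  {in keys T, f =1 fst} -> relabel f T = T.
Proof.
elim: T => //= r T IHT fT; rewrite IHT => [|c cT].
  congr cons; rewrite -[RHS]unzip1_row_keys; apply/eq_in_map => c cr.
  by apply: fT; rewrite mem_cat cr.
by apply: fT; rewrite mem_cat cT orbT.
Qed.

Lemma shape_relabel (f : std_key -> nat) (T : filling) :
  shape (relabel f T) = shape T.
Proof. by elim: T => //= r T ->; rewrite size_map size_row_keys. Qed.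

Lemma mem_keys (T : filling) (i k : nat) : k < size (nth [::] T i) ->
  (nth 0 (nth [::] T i) k, k.+1) \in keys T.
Proof.
move=> ki; have iT := size_nth_lt ki.
apply/flattenP; exists (row_keys (nth [::] T i)); first exact/map_f/mem_nth.
by apply/row_keysP; exists k.
Qed.

Lemma mem_keys_column (T : filling) (v k : nat) :
  uniq (flatten T) -> (v, k) \in keys T -> column T v = k.
Proof.
rewrite /column; elim: T => //= r T IHT; rewrite cat_uniq => /and3P[ur rT uT].
rewrite /keys /= mem_cat => /orP[/row_keysP[l lr [-> ->]]|vT].
  by rewrite mem_nth //= index_uniq.
have /negPf -> /= : v \notin r; last exact: IHT.
apply: contra rT => vr; apply/hasP; exists v => //=.
by rewrite -unzip1_keys; apply/mapP; exists (v, k).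
Qed.

Lemma keysE (T : filling) : uniq (flatten T) ->
  keys T = [seq (v, column T v) : std_key | v <- flatten T].
Proof.
move=> uT; rewrite -unzip1_keys -map_comp -[LHS]map_id.
by apply/eq_in_map => -[v k] /(mem_keys_column uT) <-.
Qed.

Lemma positive_entriesE (T : filling) :
  positive_entries T = all (leq 1) (flatten T).
Proof. by elim: T => //= r T IHT; rewrite all_cat -IHT. Qed.

Lemma ComT_uniq_keys (a : seq nat) (T : filling) : ComT a T -> uniq (keys T).
Proof.
move=> /ComTP[_ posT decT headT ruleT]; move: posT decT headT ruleT.
elim: T {a} => //= r T IHT /andP[pos_r posT] /andP[dec_r decT].
move=> /andP[head_r headT] /andP[rule_r ruleT].
rewrite /keys /= cat_uniq IHT // andbT; apply/andP; split.
  by rewrite (map_uniq (f := snd)) // -/unzip2 unzip2_zip ?size_iota ?iota_uniq.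
apply/hasPn => c /flattenP[_ /mapP[r' r'T ->] /row_keysP[k kr' ->]].
have neq : nth 0 r k != nth 0 r' k.
  apply: triple_rule_nth_neq => //; first exact: (allP rule_r).
    by rewrite ltn_eqF //; apply: (allP head_r).
  by rewrite nth_gt0 ?(allP posT).
by apply/negP => /row_keysP[l _ [e [ekl]]]; rewrite e ekl eqxx in neq.
Qed.

Definition sorted_keys (T : filling) : seq std_key := sort <=%O%O (keys T).

Lemma perm_sorted_keys (T : filling) : perm_eq (sorted_keys T) (keys T).
Proof. by rewrite perm_sort. Qed.

Lemma mem_sorted_keys (T : filling) : sorted_keys T =i keys T.
Proof. exact/perm_mem/perm_sorted_keys. Qed.

Lemma size_sorted_keys (T : filling) : size (sorted_keys T) = size (flatten T).
Proof. by rewrite size_sort size_keys. Qed.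

Lemma unzip1_sorted_keys (T : filling) :
  unzip1 (sorted_keys T) = sort leq (flatten T).
Proof.
apply/esym/perm_sort_leq.
  by rewrite -unzip1_keys perm_sym; apply/perm_map/perm_sorted_keys.
apply: (homo_sorted (e := (<=%O : rel std_key))); last exact: sort_le_sorted.
by move=> c d; rewrite leNgt lt_std_key; lia.
Qed.

(* All the conditions of a ComT compare an entry with another one weakly to its
   right, and such comparisons are insensitive to the order of equal entries. *)
Lemma eq_entry_lt_ComT (a : seq nat) (T U : filling) :
    positive_entries U -> shape U = shape T ->
    (forall i j k l, k <= l ->
       (entry U i k < entry U j l) = (entry T i k < entry T j l)) ->
  ComT a T -> ComT a U.
Proof.
move=> posU shapeU ltE [shapeT _ decT firstT ruleT].
have gt0E j k : (0 < entry U j k) = (0 < entry T j k).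
  have := ltE (size T).+1 j k k (leqnn k); rewrite {1 3}/entry /=.
  have sU : size U = size T by have /(congr1 size) := shapeU; rewrite !size_map.
  by rewrite ![nth [::] _ (size T)]nth_default ?sU // nth_nil.
split; rewrite ?shapeU //.
- apply/(all_nthP [::]) => i iU; apply/sorted_geqP => k.
  rewrite leqNgt; have := ltE i.+1 i.+1 k.+1 k.+2 (leqnSn _).
  by rewrite /entry => ->; rewrite -leqNgt; apply/sorted_geqP/all_nth.
- by move=> i j i0 ij ja; rewrite ltE ?firstT.
- move=> i j k i0 ij ja ka; rewrite -lt0n gt0E lt0n leqNgt !ltE ?leq_pred //.
  by rewrite -leqNgt; apply: ruleT.
Qed.

Lemma nth_relabel (f : std_key -> nat) (T : filling) (i k : nat) :
    positive_entries T ->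
  nth 0 (nth [::] (relabel f T) i) k =
  if 0 < nth 0 (nth [::] T i) k then f (nth 0 (nth [::] T i) k, k.+1) else 0.
Proof.
move=> posT; rewrite nth_gt0 ?all_nth //.
have size_i : size (nth [::] (relabel f T) i) = size (nth [::] T i).
  by rewrite -[i]/(i.+1.-1) -!part_shape shape_relabel.
case: ltnP => ki; last by rewrite nth_default // size_i.
rewrite (nth_map [::]) ?(size_nth_lt ki) // (nth_map key0) ?size_row_keys //.
by rewrite nth_row_keys.
Qed.

Section RelabelComT.

Variables (f : std_key -> nat) (T : filling).
Hypotheses (posT : positive_entries T) (f_gt0 : {in keys T, forall c, 0 < f c})
  (f_lt : {in keys T &, {mono f : c d / (c < d)%O >-> c < d}}).

Lemma entry_relabel_lt (i j k l : nat) : k <= l ->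
  (entry (relabel f T) i k < entry (relabel f T) j l) =
  (entry T i k < entry T j l).
Proof.
move=> kl; rewrite /entry !nth_relabel //.
have [jl|] := ltnP 0 (nth 0 (nth [::] T j.-1) l.-1); last first.
  by rewrite leqn0 => /eqP ->; rewrite !ltn0.
have jl_key := mem_keys (nth_gt0_size jl).
have [ik|] := ltnP 0 (nth 0 (nth [::] T i.-1) k.-1); last first.
  by rewrite leqn0 => /eqP ->; rewrite f_gt0 ?jl.
by rewrite f_lt ?mem_keys ?nth_gt0_size // lt_std_key /=; lia.
Qed.

Lemma positive_entries_relabel : positive_entries (relabel f T).
Proof.
rewrite positive_entriesE flatten_relabel all_map.
by apply/allP => c /f_gt0.
Qed.

Lemma ComT_relabel (a : seq nat) : ComT a (relabel f T) <-> ComT a T.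
Proof.
split; apply: eq_entry_lt_ComT; rewrite ?shape_relabel //.
- by move=> i j k l kl; rewrite entry_relabel_lt.
- exact: positive_entries_relabel.
- exact: entry_relabel_lt.
Qed.

End RelabelComT.

Definition standardize (T : filling) : filling :=
  relabel (fun c => (index c (sorted_keys T)).+1) T.

Definition destandardize (w : seq nat) (S : filling) : filling :=
  relabel (fun c => nth 0 w c.1.-1) S.

Lemma ComT_standardize (a : seq nat) (T : filling) :
  positive_entries T -> uniq (keys T) -> ComT a (standardize T) <-> ComT a T.
Proof.
move=> posT uT; apply: ComT_relabel => // c d cT dT.
by rewrite ltnS index_sort_lt.
Qed.

Lemma flatten_standardize (T : filling) : uniq (keys T) ->
  perm_eq (flatten (standardize T)) (iota 1 (size (flatten T))).
Proof.
move=> uT; rewrite flatten_relabel -size_sorted_keys.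
rewrite -map_index_uniq ?sort_uniq //.
by apply: perm_map; rewrite perm_sym perm_sorted_keys.
Qed.

Definition label_columns (S : filling) : seq nat :=
  [seq column S p | p <- iota 1 (size (flatten S))].

Definition increases_at (w s : seq nat) : bool :=
  all (fun p => nth 0 w p.-1 < nth 0 w p) s.

Lemma zip_label_columns (w : seq nat) (S : filling) :
    size w = size (flatten S) ->
  zip w (label_columns S) =
  [seq (nth 0 w p.-1, column S p) | p <- iota 1 (size w)].
Proof.
move=> sw; apply: (@eq_from_nth _ (0, 0));
  rewrite size_zip !size_map !size_iota sw minnn // => p pw.
rewrite nth_zip ?size_map ?size_iota //.
by rewrite !(nth_map 0) ?size_iota // nth_iota.
Qed.

Lemma lt_sorted_zip_label_columns (w : seq nat) (S : filling) :
    sorted leq w -> size w = size (flatten S) ->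
  sorted <%O%O (zip w (label_columns S) : seq std_key) =
  increases_at w (descents S).
Proof.
move=> /(sortedP 0) w_le sw; rewrite zip_label_columns //.
rewrite (sorted_map_iota (<%O : rel std_key)) /increases_at all_filter sw.
apply: eq_in_all => -[|p]; rewrite mem_iota // => p_w.
have {p_w} : nth 0 w p <= nth 0 w p.+1 by apply: w_le; lia.
by rewrite lt_std_key /=; lia.
Qed.

Lemma sorted_keys_standardize (T : filling) : uniq (keys T) ->
  sorted_keys T = zip (sort leq (flatten T)) (label_columns (standardize T)).
Proof.
move=> uT; rewrite -[LHS]zip_unzip unzip1_sorted_keys; congr zip.
have stdT := flatten_standardize uT.
rewrite /label_columns (perm_size stdT) size_iota -size_sorted_keys.
apply: (@eq_from_nth _ 0); rewrite !size_map ?size_iota // => p pL.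
rewrite (nth_map key0) // (nth_map 0) ?size_iota // nth_iota //.
apply/esym/mem_keys_column; first by rewrite (perm_uniq stdT) iota_uniq.
rewrite keys_relabel; apply/mapP; exists (nth key0 (sorted_keys T) p).
  by rewrite -mem_sorted_keys mem_nth.
by rewrite index_uniq // sort_uniq.
Qed.

Lemma standardize_increases_at (T : filling) : uniq (keys T) ->
  increases_at (sort leq (flatten T)) (descents (standardize T)).
Proof.
move=> uT; rewrite -lt_sorted_zip_label_columns.
- by rewrite -sorted_keys_standardize // sort_lt_sorted.
- exact/sort_sorted/leq_total.
- by rewrite size_sort (perm_size (flatten_standardize uT)) size_iota.
Qed.

Lemma standardizeK (T : filling) :
  destandardize (sort leq (flatten T)) (standardize T) = T.
Proof.
rewrite /destandardize relabel_comp; apply: relabel_id_in => c cT /=.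
rewrite -unzip1_sorted_keys (nth_map key0) ?index_mem ?mem_sorted_keys //.
by rewrite nth_index ?mem_sorted_keys.
Qed.

Section Destandardize.

Variables (w : seq nat) (S : filling).
Hypotheses (w_le : sorted leq w) (stdS : perm_eq (flatten S) (iota 1 (size w)))
  (w_incr : increases_at w (descents S)).

Let size_w : size w = size (flatten S).
Proof. by rewrite (perm_size stdS) size_iota. Qed.

Let uniq_S : uniq (flatten S).
Proof. by rewrite (perm_uniq stdS) iota_uniq. Qed.

Let zip_lt_sorted : sorted <%O%O (zip w (label_columns S) : seq std_key).
Proof. by rewrite lt_sorted_zip_label_columns. Qed.

Lemma sorted_keys_destandardize :
  sorted_keys (destandardize w S) = zip w (label_columns S).
Proof.
have := zip_lt_sorted; rewrite lt_sorted_uniq_le => /andP[_ /sort_le_id <-].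
apply/perm_sort_leP; rewrite keys_relabel keysE // -map_comp.
by rewrite zip_label_columns //; apply: perm_map.
Qed.

Lemma uniq_keys_destandardize : uniq (keys (destandardize w S)).
Proof.
rewrite -(perm_uniq (perm_sorted_keys _)) sorted_keys_destandardize.
exact: lt_sorted_uniq zip_lt_sorted.
Qed.

Lemma flatten_destandardize : perm_eq (flatten (destandardize w S)) w.
Proof.
have size_cols : size w = size (label_columns S) by rewrite size_map size_iota.
rewrite -[X in perm_eq _ X](unzip1_zip (t := label_columns S)) ?size_cols //.
rewrite -sorted_keys_destandardize -unzip1_keys perm_sym.
exact/perm_map/perm_sorted_keys.
Qed.

Lemma destandardizeK : standardize (destandardize w S) = S.
Proof.
rewrite /standardize sorted_keys_destandardize relabel_comp.
apply: relabel_id_in => -[p k] pk /=; rewrite -(mem_keys_column uniq_S pk).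
have : p \in flatten S by rewrite -unzip1_keys; apply/mapP; exists (p, k).
rewrite (perm_mem stdS) mem_iota => /andP[p0 p_w].
have {}p_w : p.-1 < size w by rewrite -ltnS prednK.
have -> : (nth 0 w p.-1, column S p) =
    nth (0, 0) (zip w (label_columns S)) p.-1.
  rewrite zip_label_columns // (nth_map 0) ?size_iota // nth_iota //.
  by rewrite add1n prednK.
rewrite index_uniq; first by rewrite prednK.
  by rewrite size_zip size_map size_iota -size_w minnn.
exact: lt_sorted_uniq zip_lt_sorted.
Qed.

End Destandardize.

Lemma standardize_bij (a w : seq nat) : sorted leq w ->
  set_bij (ComT a `&` [set T | perm_eq (flatten T) w])
          (standard_ComT a `&`
             [set S | [/\ all (leq 1) w, size (flatten S) = size w
                        & increases_at w (descents S)]])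
          standardize.
Proof.
move=> w_le; split.
- move=> T [aT Tw]; have uT := ComT_uniq_keys aT; have [Ta posT _ _ _] := aT.
  have stdT := flatten_standardize uT; split.
    split; first exact/ComT_standardize.
    by rewrite -Ta -size_flatten.
  split; first by rewrite -(perm_all _ Tw) positive_entriesE in posT *.
    by rewrite (perm_size stdT) size_iota (perm_size Tw).
  by have := standardize_increases_at uT; rewrite (perm_sort_leq Tw).
- apply: (@can_in_inj _ _ _ _ (destandardize w)) => T; rewrite inE => -[_ Tw].
  by rewrite -{1}(perm_sort_leq Tw w_le) standardizeK.
- move=> S [[aS Sa] [w_pos Sw w_incr]].
  have stdS : perm_eq (flatten S) (iota 1 (size w)).
    by rewrite -Sw (perm_size Sa) size_iota.
  have flattenS := flatten_destandardize w_le stdS w_incr.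
  have standardizeS := destandardizeK w_le stdS w_incr.
  exists (destandardize w S) => //; split=> //.
  apply/ComT_standardize; rewrite ?standardizeS //.
    by rewrite positive_entriesE (perm_all _ flattenS).
  exact: uniq_keys_destandardize.
Qed.

(** * Descent compositions *)

Lemma path_descents (T : filling) : 0 < size (flatten T) ->
  path ltn 0 (rcons (descents T) (size (flatten T))).
Proof.
move=> T0; have path_iota := iota_ltn_sorted 0 (size (flatten T)).+1.
apply: (subseq_path (s2 := iota 1 (size (flatten T))) ltn_trans) path_iota.
have := iotaD 1 (size (flatten T)).-1 1; rewrite addn1 add1n prednK // => ->.
by rewrite -cats1 cat_subseq ?filter_subseq.
Qed.

Lemma beta_composition (N : nat) (s : seq nat) :
  path ltn 0 (rcons s N) -> is_composition (beta N s).
Proof.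
rewrite /beta => sN; case: eqP => // _.
elim: (rcons s N) 0 sN => //= y t IHt x /andP[xy /IHt ->].
by rewrite subn_gt0 xy.
Qed.

Lemma partial_sums_beta (N : nat) (s : seq nat) :
  0 < N -> path ltn 0 (rcons s N) -> partial_sums (beta N s) = rcons s N.
Proof.
rewrite /beta lt0n /partial_sums => /negPf ->.
elim: (rcons s N) 0 => //= y t IHt x /andP[xy yt].
by rewrite subnKC ?IHt // ltnW.
Qed.

Lemma sumn_beta (N : nat) (s : seq nat) :
  path ltn 0 (rcons s N) -> sumn (beta N s) = N.
Proof.
rewrite /beta => sN; case: eqP => [//|_].
have sum_pairmap (t : seq nat) x : path ltn x t ->
    x + sumn (pairmap (fun x y => y - x) x t) = last x t.
  elim: t x => [|y t IHt] x /=; first by rewrite addn0.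
  by move=> /andP[xy /IHt <-]; rewrite addnA subnKC // ltnW.
by rewrite -[LHS]add0n sum_pairmap // last_rcons.
Qed.

Lemma descent_composition_composition (T : filling) :
  is_composition (descent_composition T).
Proof.
rewrite /descent_composition; have [->//|T0] := posnP (size (flatten T)).
exact/beta_composition/path_descents.
Qed.

Lemma coarsening_descents (T : filling) (m : monomial) :
  coarsening (descent_composition T) (exponents m) <->
  size (flatten T) = size m /\ increases_at (sort leq m) (descents T).
Proof.
rewrite coarseningP ?exponents_composition ?descent_composition_composition //.
rewrite sumn_exponents /descent_composition.
have [T0|T0] := posnP (size (flatten T)).
  by rewrite T0 /descents T0; split=> -[mT _]; split.
have pT := path_descents T0; rewrite sumn_beta // partial_sums_beta //.
have ascentE p : size (flatten T) = size m -> p \in descents T ->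
    (p \in partial_sums (exponents m)) =
    (nth 0 (sort leq m) p.-1 < nth 0 (sort leq m) p).
  move=> Tm; rewrite mem_filter mem_iota => pD.
  rewrite sort_exponent_tally -mem_partial_sums_tally ?sorted_exponent_tally //.
    exact: exponents_composition.
  by rewrite -/(exponents m) sumn_exponents -Tm; lia.
have subE : size (flatten T) = size m ->
    all [in partial_sums (exponents m)]
        (rcons (descents T) (size (flatten T))) =
    increases_at (sort leq m) (descents T).
  move=> Tm; rewrite all_rcons (_ : _ \in _ = true) /=.
    by apply: eq_in_all => p pD; apply: ascentE.
  rewrite Tm -sumn_exponents; apply: sumn_partial_sums.
  by apply: contraTneq T0 => m0; rewrite Tm -sumn_exponents m0.
by split=> -[Tm]; rewrite -?subE // => /allP.
Qed.

(** * Expansion of quasisymmetric Schur functions *)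

Lemma summable_SSAFs (a : seq nat) :
  summable (SSAFs a) (fun T => mono (content T)).
Proof.
move=> m; apply: (sub_finite_set _ (finite_fillings m (finite_expansions a m))).
move=> T [/SSAFsP[aT ssafT] /mono_neq0/content_perm Tm]; split=> //.
by split=> //; exists T.
Qed.

Lemma quasi_schur_SSAFs (a : seq nat) :
  quasi_schur a = psum (SSAFs a) (fun T => mono (content T)).
Proof.
rewrite (psum_fibers (f := shape) (A := expansion a)); last first.
- by move=> T /SSAFsP[].
- exact: summable_SSAFs.
apply: eq_psum => g ag; congr psum; apply/seteqP.
split=> [T gT|T [/SSAFsP[_ ssafT] <-] //].
by split; [exists g|apply: SSAF_shape].
Qed.

Lemma quasi_schur_ComT (a : seq nat) : is_composition a ->
  quasi_schur a = psum (ComT a) (fun T => mono (content T)).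
Proof.
move=> ca; rewrite quasi_schur_SSAFs [RHS](psum_reindex _ (drop_empty_bij ca)).
by apply: eq_psum => T _; rewrite /= content_drop_empty.
Qed.

Lemma eq_contentP (m : monomial) (T : filling) :
  m = content T <-> perm_eq (flatten T) (sort leq m).
Proof.
rewrite perm_sym perm_sort perm_sym; split; first exact: content_perm.
by move=> Tm; rewrite -[m]seq_mset_id; apply/esym/eq_seq_msetP.
Qed.

Lemma standardize_content_bij (a : seq nat) (m : monomial) :
  set_bij (ComT a `&` [set T | m = content T])
          (standard_ComT a `&` [set S | qsym_F_supp (descent_composition S) m])
          standardize.
Proof.
have -> : [set T | m = content T] = [set T | perm_eq (flatten T) (sort leq m)].
  by apply/eq_set => T; apply/propext/eq_contentP.
have m_pos : all (leq 1) m = (0 \notin m).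
  by apply/allP/negP => [pos_m /pos_m //|m0 [] // /m0].
have -> : [set S | qsym_F_supp (descent_composition S) m] =
    [set S | [/\ all (leq 1) (sort leq m), size (flatten S) = size (sort leq m)
                & increases_at (sort leq m) (descents S)]].
  apply/eq_set => S; rewrite size_sort all_sort m_pos; apply/propext.
  split=> [[m0 /coarsening_descents[Sm incr]] //|[m0 Sm incr]].
  by split=> //; apply/coarsening_descents.
exact/standardize_bij/sort_sorted/leq_total.
Qed.

Lemma psum_ComT_qsym_F (a : seq nat) :
  psum (ComT a) (fun T => mono (content T)) =
  psum (standard_ComT a) (fun S => qsym_F (descent_composition S)).
Proof.
apply/funext => m.
transitivity (\sum_(T \in ComT a) (`[< m = content T >]%:R : int))%R.
  by apply: eq_fsbigr => T _; rewrite (asbool_equiv_eqP eqP (iff_refl _)).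
rewrite /psum; under [RHS]eq_fsbigr do rewrite qsym_F_coef.
exact: fsum_indicator_bij (standardize_content_bij a m).
Qed.

Lemma d_SAF_ComT (a b : seq nat) : is_composition a -> d_SAF a b = d_ComT a b.
Proof.
move=> ca; apply: (card_fset_set_bij (f := drop_empty) (finite_d_SAF_set a b)).
pose std := [set T | perm_eq (flatten T) (iota 1 (sumn a)) /\
                     descent_composition T = b].
have -> : d_SAF_set a b = SSAFs a `&` std.
  apply/seteqP; split=> T.
    move=> [[g [lg ga] [gT cT]] Tb]; split; first by exists g.
    by split=> //; rewrite -ga sumn_compress; apply/eq_seq_msetP.
  move=> [[g ag gT] [Ta Tb]]; split=> //; exists g => //; split=> //.
  by case: ag => _ ga; apply/eq_seq_msetP; rewrite -sumn_compress ga.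
have -> : d_ComT_set a b = ComT a `&` std.
  by apply/seteqP; split=> T /=; [move=> [[]]|move=> [? []]].
apply: set_bij_setI; first exact: drop_empty_bij.
move=> T _; rewrite /std /= flatten_drop_empty.
by rewrite descent_composition_drop_empty.
Qed.

Lemma finite_standard_ComT (a : seq nat) : finite_set (standard_ComT a).
Proof.
apply: (sub_finite_set _ (finite_fillings (iota 1 (sumn a)) (finite_set1 a))).
by move=> S [[Sa _ _ _ _] ?].
Qed.

Local Open Scope ring_scope.

Theorem theorem6p2 (a : seq nat) (ha : is_composition a) :
  quasi_schur a = psum composition_set (fun b => qsym_F b *+ d_SAF a b) /\
  (forall b : seq nat, is_composition b -> d_SAF a b = d_ComT a b).
Proof.
split=> [|b _]; last exact: d_SAF_ComT.
have finS := finite_standard_ComT a.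
rewrite quasi_schur_ComT // psum_ComT_qsym_F.
rewrite (psum_fibers (f := descent_composition) (A := composition_set));
  last first.
- by move=> S _; apply: descent_composition_composition.
- by move=> m; apply: finite_setIl.
apply: eq_psum => b _.
rewrite d_SAF_ComT // -psum_const; last exact: finite_setIl.
by apply: eq_psum => S [_ <-].
Qed.
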